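(* Let $\mathcal G$ be a locally compact Hausdorff $\sigma$-compact étale ample groupoid with compact unit space. If $\mathcal G$ is minimal and almost finite in Matui's sense, then $\mathcal G$ is almost elementary.
   Context: Ample: basis of compact open bisections. $Au=\{x\in A:s(x)=u\}$, $AB=\{xy:x\in A,y\in B,s(x)=r(y)\}$. Matui's almost finiteness: for every compact $K\subseteq\mathcal G$ and $\varepsilon>0$ there is a compact open principal subgroupoid $\mathcal H$ with $\mathcal H^{(0)}=\mathcal G^{(0)}$ and $|K\mathcal Hu\setminus\mathcal Hu|<\varepsilon|\mathcal Hu|$ for all $u\in\mathcal G^{(0)}$. Multisection: finite family $\{C_{i,j}:i,j\in F\}$ of bisections with $C_{i,j}C_{j,k}=C_{i,k}$ and pairwise disjoint levels $C_{i,i}\subseteq\mathcal G^{(0)}$. Castle: finite family $\{C^l_{i,j}:i,j\in F_l,l\in I\}$ of multisections with $C^l_{i,j}C^{l'}_{i',j'}=\emptyset$ for $l\ne l'$; open if all members open. $\mathcal C$ is $K$-extendable to $\mathcal D=\{D^l_{i,j}:i,j\in E_l,l\in I\}$ if $F_l\subseteq E_l$, $C^l_{i,j}=D^l_{i,j}$ for $i,j\in F_l$, and $K\cdot\bigcup\mathcal C\subseteq\bigcup\mathcal D$. $K\prec_{\mathcal G}V$: there are open bisections $A_1,\dots,A_n$ with $K\subseteq\bigcup s(A_i)$ and $r(A_i)$ pairwise disjoint subsets of $V$. Almost elementary: for every compact $K\supseteq\mathcal G^{(0)}$, nonempty open $O\subseteq\mathcal G^{(0)}$ and open cover $\mathcal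 V$ of $\mathcal G^{(0)}$ there are open castles $\mathcal C,\mathcal D$, $\mathcal C$ $K$-extendable to $\mathcal D$, each level of $\mathcal D$ contained in a member of $\mathcal V$, and $\mathcal G^{(0)}\setminus\bigcup(\text{levels of }\mathcal C)\prec_{\mathcal G}O$. *)

(* Defs.v *)
From HB Require Import structures.
From mathcomp Require Import all_boot all_order all_algebra.
From mathcomp Require Import all_classical all_reals all_analysis.
From mathcomp Require Import Rstruct Rstruct_topology.
From Stdlib Require Import Rdefinitions.
From mathcomp Require Import finmap.
Set Implicit Arguments. Unset Strict Implicit. Unset Printing Implicit Defensive.
Import Order.TTheory GRing.Theory Num.Theory.
Local Open Scope classical_set_scope.

Section Groupoids.
Context {T : topologicalType}.
Variables (G0 : set T) (s r : T -> T) (mul : T -> T -> T) (inv : T -> T).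

(* algebraic groupoid axioms; x y composable iff s x = r y; unit space G0 *)
Definition groupoid_axioms : Prop :=
  [/\ (forall x, G0 (s x) /\ G0 (r x)),
      (forall u, G0 u -> s u = u /\ r u = u),
      (forall x y, s x = r y -> s (mul x y) = s y /\ r (mul x y) = r x),
      (forall x y z, s x = r y -> s y = r z -> mul (mul x y) z = mul x (mul y z)) &
      (forall x, mul (r x) x = x /\ mul x (s x) = x)] /\
      (forall x, [/\ s (inv x) = r x, r (inv x) = s x,
                     mul x (inv x) = r x & mul (inv x) x = s x]).

Definition local_homeo (f : T -> T) : Prop :=
  forall x, exists U : set T,
    [/\ open U, U x,
        (forall y z, U y -> U z -> f y = f z -> y = z),
        {within U, continuous f} &
        (forall V, open V -> V `<=` U -> open (f @` V))].

Definition etale_groupoid : Prop :=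
  [/\ groupoid_axioms,
      continuous s, continuous r, continuous inv &
      {within [set p : T * T | s p.1 = r p.2], continuous (fun p => mul p.1 p.2)}] /\
      (local_homeo r /\ local_homeo s).

Definition sigma_compact : Prop :=
  exists K : nat -> set T, (forall n, compact (K n)) /\ \bigcup_n K n = [set: T].

Definition bisection (B : set T) : Prop :=
  (forall x y, B x -> B y -> s x = s y -> x = y) /\
  (forall x y, B x -> B y -> r x = r y -> x = y).

Definition ample : Prop :=
  forall x (U : set T), open U -> U x ->
    exists B, [/\ compact B, open B, bisection B, B x & B `<=` U].

Definition setprod (A B : set T) : set T :=
  [set z | exists x y, [/\ A x, B y, s x = r y & z = mul x y]].

Definition fibre (A : set T) (u : T) : set T := [set x | A x /\ s x = u].

Definition minimal_groupoid : Prop :=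
  forall u, G0 u -> G0 `<=` closure [set r x | x in [set x | s x = u]].

Definition principal_subgroupoid (H : set T) : Prop :=
  [/\ (forall x y, H x -> H y -> s x = r y -> H (mul x y)),
      (forall x, H x -> H (inv x)) &
      (forall x, H x -> s x = r x -> G0 x)].

Definition fcard (A : set T) : nat := (#|` fset_set A|)%fset.

Definition almost_finite : Prop :=
  forall (K : set T) (eps : R), compact K -> (0 < eps)%R ->
    exists H : set T,
      [/\ compact H, open H, principal_subgroupoid H, G0 `<=` H &
      forall u, G0 u ->
        [/\ finite_set (fibre H u),
            finite_set (setprod K (fibre H u) `\` fibre H u) &
            (GRing.natmul (1 : R) (fcard (setprod K (fibre H u) `\` fibre H u))
               < eps * GRing.natmul (1 : R) (fcard (fibre H u)))%R]].

Definition multisection (F : set nat) (C : nat -> nat -> set T) : Prop :=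
  [/\ finite_set F,
      (forall i j, F i -> F j -> bisection (C i j)),
      (forall i j k, F i -> F j -> F k -> setprod (C i j) (C j k) = C i k),
      (forall i, F i -> C i i `<=` G0) &
      (forall i j, F i -> F j -> i <> j -> C i i `&` C j j = set0)].

Definition castle (I : set nat) (F : nat -> set nat)
    (C : nat -> nat -> nat -> set T) : Prop :=
  [/\ finite_set I,
      (forall l, I l -> multisection (F l) (C l)) &
      (forall l l' i j i' j', I l -> I l' -> l <> l' ->
         F l i -> F l j -> F l' i' -> F l' j' ->
         setprod (C l i j) (C l' i' j') = set0)].

Definition open_castle I F C : Prop :=
  castle I F C /\ (forall l i j, I l -> F l i -> F l j -> open (C l i j)).

Definition castle_union (I : set nat) (F : nat -> set nat)
    (C : nat -> nat -> nat -> set T) : set T :=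
  [set x | exists l i j, [/\ I l, F l i, F l j & C l i j x]].

Definition castle_levels (I : set nat) (F : nat -> set nat)
    (C : nat -> nat -> nat -> set T) : set T :=
  [set x | exists l i, [/\ I l, F l i & C l i i x]].

Definition extendable (K : set T) (I : set nat) (F : nat -> set nat)
    (C : nat -> nat -> nat -> set T) (E : nat -> set nat)
    (D : nat -> nat -> nat -> set T) : Prop :=
  [/\ (forall l, I l -> F l `<=` E l),
      (forall l i j, I l -> F l i -> F l j -> C l i j = D l i j) &
      setprod K (castle_union I F C) `<=` castle_union I E D].

Definition subequiv (K V : set T) : Prop :=
  exists (n : nat) (A : nat -> set T),
    [/\ (forall i : nat, (i < n)%N -> open (A i) /\ bisection (A i)),
        K `<=` \bigcup_(i in [set i : nat | (i < n)%N]) (s @` A i),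
        (forall i : nat, (i < n)%N -> r @` A i `<=` V) &
        (forall i j : nat, (i < n)%N -> (j < n)%N -> i <> j ->
           r @` A i `&` r @` A j = set0)].

Definition almost_elementary : Prop :=
  forall (K O : set T) (Vs : set (set T)),
    compact K -> G0 `<=` K ->
    open O -> O `<=` G0 -> O !=set0 ->
    (forall V, Vs V -> open V /\ V `<=` G0) ->
    G0 `<=` \bigcup_(V in Vs) V ->
    exists (I : set nat) (F E : nat -> set nat) (C D : nat -> nat -> nat -> set T),
      [/\ open_castle I F C, open_castle I E D,
          extendable K I F C E D,
          (forall l i, I l -> E l i -> exists2 V, Vs V & D l i i `<=` V) &
          subequiv (G0 `\` castle_levels I F C) O].

End Groupoids.

(* Main.v *)
Require Import Defs.
From HB Require Import structures.
From mathcomp Require Import all_boot all_order all_algebra finmap.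
From mathcomp Require Import all_classical all_reals all_analysis.
From mathcomp Require Import zify.
From mathcomp Require Import Rstruct Rstruct_topology.
Set Implicit Arguments. Unset Strict Implicit. Unset Printing Implicit Defensive.
Import Order.TTheory GRing.Theory Num.Theory.
Local Open Scope classical_set_scope.

(** Shrink O to a compact open set. By minimality and ampleness there are M
    compact open bisections whose union K' contains K and, over every unit v, an
    arrow from v into O. Almost finiteness yields a compact open principal H with
    (M + 1) M |K'Hu \ Hu| <= |Hu|. The clopen set B = s(K' \ H) consists of the
    units from which K' leaves H. Translating by arrows of K' is at most M-to-one,
    so at most M |K'Hu \ Hu| points of the H-orbit of u lie in B, while the number
    of points outside B is at most M times the number of points in O; hence each
    H-orbit has at least as many points in O as in B.

    Choose a clopen partition P of the unit space, fine enough that each H-orbit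
    meets every piece at most once, subordinate to the given cover and compatible
    with B and O. The type of a unit is the set of pieces that its H-orbit meets;
    it is H-invariant and locally constant. The arrows of H sorted by type, range
    piece and source piece form the castle D, and C keeps the pieces disjoint from
    B. In each type the pieces inside B inject into the pieces inside O, and the
    corresponding members of D witness that B is subequivalent to O. *)

(** * Finite covers and clopen partitions of compact sets *)

Lemma compact_finite_cover (T : topologicalType) (A : set T) (Q : set T -> Prop) :
  compact A -> (forall x, A x -> exists U, [/\ open U, U x & Q U]) ->
  exists n (U : 'I_n -> set T), (forall i, Q (U i)) /\ A `<=` \bigcup_i U i.
Proof.
move=> cA AQ.
have [-> | /set0P[x0 Ax0]] := eqVneq A set0.
  by exists 0%N, (fun=> set0); split=> [[]|]//; exact: sub0set.
(* The covering form of compactness is applied over a pointed space; a point of the nonempty [A]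
   serves as base point. *)
pose T' : ptopologicalType := HB.pack T (isPointed.Build T x0).
have /choice[f fP] (x : T') : exists U : set T, A x -> [/\ open U, U x & Q U].
  by have [/AQ[U ?]|] := pselect (A x); [exists U|exists set0].
have : @cover_compact T' A by rewrite -compact_cover.
move=> /(_ T' A f)[x /fP[]//|x Ax|D DA Acov].
  by exists x => //; have [] := fP _ Ax.
exists #|{: D}|, (fun i => f (val (enum_val i))); split=> [i|x /Acov[d /= dD fx]].
  by have := DA _ (valP (enum_val i)); rewrite inE => /fP[].
by exists (enum_rank [` dD]%fset) => //; rewrite enum_rankK.
Qed.

Lemma bigcup_fin_compact (T : topologicalType) (J : finType) (U : J -> set T) :
  (forall i, compact (U i)) -> compact (\bigcup_i U i).
Proof.
move=> cU; rewrite (_ : \bigcup_i U i = \big[setU/set0]_(i in predT) U i).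
  exact: bigsetU_compact.
by rewrite -bigcup_pred; apply: eq_bigcupl; split.
Qed.

Lemma compact_setD (T : topologicalType) (A B : set T) :
  compact A -> open B -> compact (A `\` B).
Proof. by move=> cA oB; rewrite setDE; apply: compact_closedI => //; exact: open_closedC. Qed.

Lemma open_setD (T : topologicalType) (A B : set T) :
  open A -> closed B -> open (A `\` B).
Proof. by move=> oA cB; rewrite setDE; apply: openI => //; exact: closed_openC. Qed.

(** Removing from each member of a finite compact open cover the earlier members makes the cover
    disjoint. The pieces remain compact and open, and [Q] survives because it passes to subsets. *)
Lemma fine_clopen_partition (T : topologicalType) (A : set T) (Q : set T -> Prop) :
  hausdorff_space T -> compact A ->
  (forall U V, V `<=` U -> Q U -> Q V) ->
  (forall x, A x -> exists U, [/\ compact U, open U, U x & Q U]) ->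
  exists m (P : 'I_m -> set T),
    [/\ forall k, [/\ compact (P k), open (P k) & Q (P k)],
        forall j k x, P j x -> P k x -> j = k &
        forall x, A x -> exists k, P k x].
Proof.
move=> hT cA Qsub loc.
have [x Ax|n [U [UP cov]]] :=
    @compact_finite_cover _ A (fun U => [/\ compact U, open U & Q U]) cA.
  by have [U [? ? ? ?]] := loc _ Ax; exists U.
pose P k := U k `\` \bigcup_(j in [set j : 'I_n | (j < k)%N]) U j.
exists n, P; split.
- move=> k; have [cU oU QU] := UP k; split.
  + by apply: compact_setD => //; apply: bigcup_open => j _; have [] := UP j.
  + apply: open_setD => //; apply: closed_bigcup => [|j _]; first exact: finite_finset.
    by apply: compact_closed => //; have [] := UP j.
  + by apply: Qsub QU => x [].
- move=> j k x [Ujx Nj] [Ukx Nk]; case: (ltngtP j k) => [jk|kj|/val_inj//].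
  + by exfalso; apply: Nk; exists j.
  + by exfalso; apply: Nj; exists k.
(* The piece containing [x] is the one whose index is the least [i] with [U i x]. *)
- move=> x /cov[i0 _ Ux].
  case: (arg_minnP (fun i : 'I_n => val i) (P := fun i => `[< U i x >]) (i0 := i0)).
    exact/asboolP.
  move=> i /asboolP Uix imin; exists i; split=> // -[j /= ji Ujx].
  by have := imin j (asboolT Ujx); rewrite leqNgt ji.
Qed.

(** * Cardinality comparisons between finite sets *)

Lemma card_fset_set_le_mul (S T : choiceType) (M : nat) (X : set S) (Y : set T)
    (Rel : 'I_M -> S -> T -> Prop) :
  finite_set X -> finite_set Y ->
  (forall x, X x -> exists i y, Y y /\ Rel i x y) ->
  (forall i x x' y, X x -> X x' -> Rel i x y -> Rel i x' y -> x = x') ->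
  (#|` fset_set X| <= M * #|` fset_set Y|)%N.
Proof.
move=> fX fY tot inj.
have XP (x : fset_set X) : X (val x) by have := valP x; rewrite in_fset_set// inE.
(* Choosing a related pair [(i, y)] for each [x] gives an injection of [X] into the product of
   ['I_M] and [Y]. *)
have /choice[g gP] (x : fset_set X) :
    exists p : 'I_M * fset_set Y, Rel p.1 (val x) (val p.2).
  have [i [y [Yy Rxy]]] := tot _ (XP x).
  have yY : y \in fset_set Y by rewrite in_fset_set// inE.
  by exists (i, [` yY]%fset).
have ginj : injective g.
  move=> x x' gE; apply: val_inj; apply: inj (XP _) (XP _) (gP x) _.
  by rewrite gE; exact: gP.
by have := leq_card g ginj; rewrite card_prod card_ord -!cardfE.
Qed.

Lemma card_fset_set_le_inj (S : choiceType) (A B : set S) :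
  finite_set A -> finite_set B -> (#|` fset_set A| <= #|` fset_set B|)%N ->
  exists f : S -> S, (forall x, A x -> B (f x)) /\
    (forall x y, A x -> A y -> f x = f y -> x = y).
Proof.
move=> fA fB le.
(* Elements of equal rank in the two enumerations are matched; on [A] the bound [idx] keeps the
   default value of [nth] from occurring. *)
pose f x := nth x (fset_set B) (index x (fset_set A)).
have idx x : A x -> (index x (fset_set A) < #|` fset_set B|)%N.
  by move=> Ax; apply: leq_trans le; rewrite index_mem in_fset_set// inE.
exists f; split=> [x Ax|x y Ax Ay].
  have : f x \in fset_set B by apply: mem_nth; exact: idx.
  by rewrite in_fset_set// inE.
(* The two sides carry the defaults [x] and [y], which must agree before [nth_uniq] applies. *)
rewrite /f (set_nth_default x y) ?idx// => /eqP.
rewrite nth_uniq ?idx ?fset_uniq// => /eqP eq_idx.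
have mA z : A z -> z \in fset_set A by rewrite in_fset_set// inE.
by rewrite -(nth_index x (mA _ Ax)) eq_idx nth_index// mA.
Qed.

Lemma local_homeo_open (T : topologicalType) (f : T -> T) (A : set T) :
  local_homeo f -> open A -> open (f @` A).
Proof.
move=> lh oA; rewrite openE => _ [x Ax <-].
have [U [oU Ux _ _ Uop]] := lh x.
apply: (@filterS _ _ _ (f @` (A `&` U))); first by apply: image_subset => ? [].
apply: open_nbhs_nbhs; split; last by exists x.
by apply: Uop => [|? []//]; exact: openI.
Qed.

(** * Groupoid calculus and principal subgroupoids *)

Section Groupoid.
Context {T : topologicalType} (G0 : set T) (s r : T -> T)
  (mul : T -> T -> T) (inv : T -> T).
Hypothesis grpd : groupoid_axioms G0 s r mul inv.

Lemma unit_s x : G0 (s x). Proof. by have [[/(_ x)[]]] := grpd. Qed.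
Lemma unit_r x : G0 (r x). Proof. by have [[/(_ x)[]]] := grpd. Qed.
Lemma s_unit u : G0 u -> s u = u. Proof. by have [[_ /(_ u) h _ _ _] _] := grpd => /h[]. Qed.
Lemma r_unit u : G0 u -> r u = u. Proof. by have [[_ /(_ u) h _ _ _] _] := grpd => /h[]. Qed.
Lemma s_mul x y : s x = r y -> s (mul x y) = s y.
Proof. by have [[_ _ /(_ x y) h _ _] _] := grpd => /h[]. Qed.
Lemma r_mul x y : s x = r y -> r (mul x y) = r x.
Proof. by have [[_ _ /(_ x y) h _ _] _] := grpd => /h[]. Qed.
Lemma mul_assoc x y z :
  s x = r y -> s y = r z -> mul (mul x y) z = mul x (mul y z).
Proof. by have [[_ _ _ h _] _] := grpd; exact: h. Qed.
Lemma mul_rl x : mul (r x) x = x. Proof. by have [[_ _ _ _ /(_ x)[]]] := grpd. Qed.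
Lemma mul_sr x : mul x (s x) = x. Proof. by have [[_ _ _ _ /(_ x)[]]] := grpd. Qed.
Lemma s_inv x : s (inv x) = r x. Proof. by have [_ /(_ x)[]] := grpd. Qed.
Lemma r_inv x : r (inv x) = s x. Proof. by have [_ /(_ x)[]] := grpd. Qed.
Lemma mul_inv x : mul x (inv x) = r x. Proof. by have [_ /(_ x)[]] := grpd. Qed.
Lemma inv_mul x : mul (inv x) x = s x. Proof. by have [_ /(_ x)[]] := grpd. Qed.

Lemma mulKV x y : s x = r y -> mul (inv x) (mul x y) = y.
Proof. by move=> xy; rewrite -mul_assoc ?s_inv// inv_mul xy mul_rl. Qed.

Lemma mulVK x y : s x = r y -> mul (mul x y) (inv y) = x.
Proof. by move=> xy; rewrite mul_assoc ?r_inv// mul_inv -xy mul_sr. Qed.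

Lemma mulrVK x y : s x = s y -> mul (mul x (inv y)) y = x.
Proof. by move=> xy; rewrite mul_assoc ?r_inv ?s_inv// inv_mul -xy mul_sr. Qed.

(* On a neighbourhood U of a unit where r is injective, a point x of U with r x in U
   satisfies r (r x) = r x, hence x = r x. *)
Lemma unit_space_open : continuous r -> local_homeo r -> open G0.
Proof.
move=> cr lr; rewrite openE => u Gu; have [U [oU Uu injU _ _]] := lr u.
apply: (@filterS _ _ _ (U `&` r @^-1` U)) => [x [Ux /= Urx]|].
  by rewrite -(injU _ _ Urx Ux (r_unit (unit_r x))); exact: unit_r.
apply: open_nbhs_nbhs; split; last by split=> //=; rewrite r_unit.
by apply: openI => //; apply: open_comp => // x _; exact: cr.
Qed.

Section Principal.
Variable H : set T.
Hypothesis prH : principal_subgroupoid G0 s r mul inv H.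

Lemma principal_mul x y : H x -> H y -> s x = r y -> H (mul x y).
Proof. by have [h _ _] := prH; exact: h. Qed.
Lemma principal_inv x : H x -> H (inv x).
Proof. by have [_ h _] := prH; exact: h. Qed.
Lemma principal_unit x : H x -> s x = r x -> G0 x.
Proof. by have [_ _ h] := prH; exact: h. Qed.

(** The quotient [mul x (inv y)] is an arrow of [H] with equal source and range, hence a unit by
    principality. *)
Lemma principal_eq x y : H x -> H y -> s x = s y -> r x = r y -> x = y.
Proof.
move=> Hx Hy sxy rxy.
have com : s x = r (inv y) by rewrite r_inv.
have Hz : H (mul x (inv y)) by apply: principal_mul => //; exact: principal_inv.
have Gz : G0 (mul x (inv y)).
  by apply: principal_unit => //; rewrite s_mul// r_mul// s_inv.
by rewrite -[LHS](mulrVK sxy) -(r_unit Gz) r_mul// rxy mul_rl.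
Qed.

(** By principality every nonunit of [H] has an end other than [u], and the Hausdorff property keeps
    that end away from [u] for all nearby arrows. The nonunits of [H] form a compact set, so
    finitely many neighbourhoods of [u] are intersected. *)
Lemma principal_separation (u : T) :
  hausdorff_space T -> continuous s -> continuous r -> open G0 -> compact H ->
  exists N, nbhs u N /\ forall z, H z -> N (r z) -> N (s z) -> G0 z.
Proof.
move=> hT cs cr oG cH.
have sep (f : T -> T) z : continuous f -> f z <> u ->
    exists U N, [/\ open U, U z, nbhs u N & forall z', U z' -> ~ N (f z')].
  move=> cf /eqP fzu; move: (hT); rewrite open_hausdorff => /(_ _ _ fzu).
  case=> -[A B] /= [/set_mem Afz /set_mem Bu] [oA oB /eqP AB].
  exists (f @^-1` A), B; split => //.
  - by apply: open_comp => // x _; exact: cf.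
  - exact: open_nbhs_nbhs.
  - by move=> z' Az' Bz'; have : (A `&` B) (f z') by []; rewrite AB.
have [|z [Hz NGz]|n [U [UP cov]]] := @compact_finite_cover _ (H `\` G0)
    (fun U => exists2 N, nbhs u N & forall z, U z -> N (r z) -> N (s z) -> False).
- exact: compact_setD.
- have [rzu|rzu] := pselect (r z = u); last first.
    by have [U [N [? ? ? NP]]] := sep _ _ cr rzu; exists U; split=> //; exists N => // ? /NP.
  have [szu|szu] := pselect (s z = u).
    by exfalso; apply: NGz; apply: principal_unit => //; rewrite szu.
  by have [U [N [? ? ? NP]]] := sep _ _ cs szu; exists U; split=> //; exists N => // ? /NP.
have /choice[N NP] : forall i, exists N, nbhs u N /\
    forall z, U i z -> N (r z) -> N (s z) -> False.
  by move=> i; have [N ? ?] := UP i; exists N.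
exists [set x | forall i, N i x]; split.
  by apply: filter_forall => i; have [] := NP i.
move=> z Hz Nr Ns; apply: contrapT => NGz.
have [i _ Uz] : (\bigcup_i U i) z by apply: cov.
by have [_] := NP i; apply; [exact: Uz|exact: Nr|exact: Ns].
Qed.

End Principal.

(* A pair (i, kx) determines x: its range determines the arrow k of the
   bisection [Bs i], and k can be cancelled. *)
Lemma card_translate_le (M : nat) (Bs : 'I_M -> set T) (X Y : set T) :
  (forall i, bisection s r (Bs i)) -> finite_set X -> finite_set Y ->
  (forall x, X x -> exists i k, [/\ Bs i k, s k = r x & Y (mul k x)]) ->
  (#|` fset_set X| <= M * #|` fset_set Y|)%N.
Proof.
move=> bis fX fY tr.
apply: (@card_fset_set_le_mul _ _ _ _ _
  (fun i x y => exists k, [/\ Bs i k, s k = r x & y = mul k x])) => //.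
- by move=> x /tr[i [k [? ? ?]]]; exists i, (mul k x); split=> //; exists k.
- move=> i x x' y _ _ [k [Bk kx ->]] [k' [Bk' kx' eq_y]].
  have kk' : k = k'.
    by have [_] := bis i; apply => //; rewrite -(r_mul kx) eq_y r_mul.
  by rewrite -(mulKV kx) eq_y -kk' mulKV// kk'.
Qed.
End Groupoid.

(** * Subequivalence witnessed by a family over a finite type *)

Lemma subequiv_finType (T : topologicalType) (s r : T -> T) (J : finType)
    (A : J -> set T) (K V : set T) :
  (forall j, open (A j) /\ bisection s r (A j)) ->
  K `<=` \bigcup_j (s @` A j) -> (forall j, r @` A j `<=` V) ->
  (forall j j' x x', A j x -> A j' x' -> r x = r x' -> j = j') ->
  subequiv s r K V.
Proof.
move=> obA cov rV dis.
(* The family is renumbered by the enumeration of [J] and padded with [set0] from [#|J|] on. *)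
pose A' i := if insub i is Some o then A (enum_val (o : 'I_#|J|)) else set0.
have A'E (i : 'I_#|J|) : A' i = A (enum_val i).
  by rewrite /A' insubT// => ?; rewrite /= (_ : Sub _ _ = i)//; exact: val_inj.
exists #|J|, A'; split.
- by move=> i iJ; rewrite (A'E (Ordinal iJ)).
- move=> x /cov[j _ [y Ay yx]]; exists (val (enum_rank j)) => /=; first exact: ltn_ord.
  by rewrite A'E enum_rankK; exists y.
- by move=> i iJ; rewrite (A'E (Ordinal iJ)).
- move=> i j iJ jJ ij; rewrite (A'E (Ordinal iJ)) (A'E (Ordinal jJ)).
  apply/seteqP; split=> // _ [[x Ax <-] [y Ay yx]].
  by have /enum_val_inj[] := dis _ _ _ _ Ax Ay (esym yx).
Qed.

(** * Castles sorted by orbit type *)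

Section OrbitTypeCastle.
Context {T : topologicalType} (G0 : set T) (s r : T -> T)
  (mul : T -> T -> T) (inv : T -> T) (H : set T) (m : nat) (P : 'I_m -> set T).
Hypothesis grpd : groupoid_axioms G0 s r mul inv.
Hypothesis prH : principal_subgroupoid G0 s r mul inv H.
Hypothesis G0H : G0 `<=` H.
Hypothesis Pdisj : forall j k x, P j x -> P k x -> j = k.
Hypothesis Pcov : forall x, G0 x -> exists k, P k x.
Hypothesis Psep : forall k z, H z -> P k (r z) -> P k (s z) -> G0 z.

Definition orbit_type (v : T) : {set 'I_m} :=
  [set k | `[< exists z, [/\ H z, s z = v & P k (r z)] >]]%SET.

Lemma orbit_typeP v k :
  reflect (exists z, [/\ H z, s z = v & P k (r z)]) (k \in orbit_type v).
Proof. by rewrite inE; exact: asboolP. Qed.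

(** An arrow [y] leaving [s z] turns into [mul y (inv z)], which leaves [r z] and has the same
    range. *)
Lemma orbit_type_sub z k : H z -> k \in orbit_type (s z) -> k \in orbit_type (r z).
Proof.
move=> Hz /orbit_typeP[y [Hy yz Pk]]; apply/orbit_typeP.
have com : s y = r (inv z) by rewrite (r_inv grpd).
exists (mul y (inv z)); split.
- by apply: (principal_mul prH) => //; exact: principal_inv prH _ _.
- by rewrite (s_mul grpd)// (s_inv grpd).
- by rewrite (r_mul grpd).
Qed.

Lemma orbit_type_invariant z : H z -> orbit_type (r z) = orbit_type (s z).
Proof.
move=> Hz; apply/setP => k; apply/idP/idP; last exact: orbit_type_sub.
move=> kr; rewrite -(r_inv grpd z); apply: orbit_type_sub.
  exact: principal_inv prH _ _.
by rewrite (s_inv grpd).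
Qed.

Lemma mem_orbit_type z k : H z -> P k (r z) -> k \in orbit_type (s z).
Proof. by move=> Hz Pk; apply/orbit_typeP; exists z. Qed.

(** Castles are indexed by natural numbers, so types are coded by [pickle]. Testing the type at the
    source suffices, as it is the same at the range. *)
Definition orbit_tower (l i j : nat) : set T :=
  [set z | exists a b : 'I_m, [/\ i = a, j = b, H z, P a (r z) & P b (s z)] /\
                             choice.pickle (orbit_type (s z)) = l].

(** The predicate [Q] selects pieces: the constantly true one serves the large castle, avoidance of
    [B] the small one. *)
Definition tower_index (Q : set T -> Prop) (l : nat) : set nat :=
  [set i : nat | exists (tau : {set 'I_m}) (a : 'I_m),
     [/\ choice.pickle tau = l, a \in tau, i = a & Q (P a)]].

(** If the sources agree, [mul x (inv y)] starts and ends in one piece, so [Psep] makes it a unit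
    and the ranges agree too; [principal_eq] concludes. For equal ranges [mul (inv x) y] plays this
    part. *)
Lemma orbit_tower_bisection l i j : bisection s r (orbit_tower l i j).
Proof.
split=> x y [a [b [[-> -> Hx Pax Pbx] _]]] [a' [b' [[aa' bb' Hy Pay Pby] _]]] xy.
  have {aa'}? := val_inj aa'; subst a'.
  have com : s x = r (inv y) by rewrite (r_inv grpd).
  have Gz : G0 (mul x (inv y)).
    apply: (@Psep a).
    - by apply: (principal_mul prH) => //; exact: principal_inv prH _ _.
    - by rewrite (r_mul grpd).
    - by rewrite (s_mul grpd)// (s_inv grpd).
  apply: (principal_eq grpd prH) => //.
  rewrite -(r_mul grpd com) (r_unit grpd Gz) -[LHS](s_unit grpd Gz).
  by rewrite (s_mul grpd com) (s_inv grpd).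
have {bb'}? := val_inj bb'; subst b'.
have com : s (inv x) = r y by rewrite (s_inv grpd).
have Gz : G0 (mul (inv x) y).
  apply: (@Psep b).
  - by apply: (principal_mul prH) => //; exact: principal_inv prH _ _.
  - by rewrite (r_mul grpd)// (r_inv grpd).
  - by rewrite (s_mul grpd).
apply: (principal_eq grpd prH) => //.
rewrite -(r_inv grpd x) -(r_mul grpd com) (r_unit grpd Gz).
by rewrite -[LHS](s_unit grpd Gz) (s_mul grpd com).
Qed.

Lemma orbit_tower_unit l i : orbit_tower l i i `<=` G0.
Proof.
move=> z [a [b [[-> /val_inj <- Hz Pa Pb] _]]]; exact: Psep Hz Pa Pb.
Qed.

Lemma orbit_tower_range l i j z : orbit_tower l i j z ->
  exists a : 'I_m, [/\ i = a, P a (r z) & choice.pickle (orbit_type (r z)) = l].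
Proof.
by move=> [a [b [[-> _ Hz Pa _] ty]]]; exists a; rewrite orbit_type_invariant.
Qed.

(** The inclusion from right to left holds because piece [j] belongs to the type: the orbit of [s z]
    has a point there, and [z] factors through that point. *)
Lemma orbit_tower_prod l i j k (Q : set T -> Prop) : tower_index Q l j ->
  setprod s r mul (orbit_tower l i j) (orbit_tower l j k) = orbit_tower l i k.
Proof.
move=> [tau [c [tauE ctau jE _]]]; apply/seteqP; split.
  move=> _ [x [y [[a [b [[ia jb Hx Pax Pbx] xl]]] [b' [d [[jb' kd Hy Pby Pdy] yl]]] xy ->]]].
  exists a, d; rewrite (s_mul grpd)// (r_mul grpd)//; split=> //; split=> //.
  exact: (principal_mul prH).
move=> z [a [b [[ia kb Hz Pa Pb] zl]]].
have : c \in orbit_type (s z) by rewrite (pcan_inj choice.pickleK (etrans zl (esym tauE))).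
move=> /orbit_typeP[w [Hw wz Pc]].
have com : s z = r (inv w) by rewrite (r_inv grpd).
exists (mul z (inv w)), w; split.
- exists a, c; rewrite (s_mul grpd)// (r_mul grpd)// (s_inv grpd); split.
    by split=> //; apply: (principal_mul prH) => //; exact: principal_inv prH _ _.
  by rewrite orbit_type_invariant// wz.
- by exists c, b; rewrite wz.
- by rewrite (s_mul grpd)// (s_inv grpd).
- by rewrite (mulrVK grpd).
Qed.

Lemma orbit_towers_cover z : H z -> exists i j,
  [/\ tower_index (fun=> True) (choice.pickle (orbit_type (s z))) i,
      tower_index (fun=> True) (choice.pickle (orbit_type (s z))) j &
      orbit_tower (choice.pickle (orbit_type (s z))) i j z].
Proof.
move=> Hz; have [a Pa] := Pcov (unit_r grpd z); have [b Pb] := Pcov (unit_s grpd z).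
exists a, b; split; last by exists a, b.
  by exists (orbit_type (s z)), a; split=> //; exact: mem_orbit_type.
exists (orbit_type (s z)), b; split=> //.
(* The unit at [s z], itself an arrow of [H], puts the source piece into the type. *)
have Gs := unit_s grpd z.
rewrite -(s_unit grpd Gs); apply: mem_orbit_type; first exact: G0H.
by rewrite (r_unit grpd).
Qed.

Section Topology.
Hypothesis hT : hausdorff_space T.
Hypotheses (cs : continuous s) (cr : continuous r) (ls : local_homeo s).
Hypotheses (oG0 : open G0) (cH : compact H) (oH : open H).
Hypotheses (cP : forall k, compact (P k)) (oP : forall k, open (P k)).

(** The type of a unit records its membership in the finitely many sets [A k]. Each is open because
    [s] is a local homeomorphism, and closed because it is a continuous image of a compact set. *)
Lemma open_type (tau : {set 'I_m}) : open [set v | G0 v /\ orbit_type v = tau].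
Proof.
pose A k := s @` (H `&` r @^-1` P k).
have AE v k : (k \in orbit_type v) = (v \in A k).
  apply/orbit_typeP/idP; rewrite inE => -[z]; first by move=> [? ? ?]; exists z.
  by move=> [? ?] ?; exists z.
have oA k : open (A k).
  apply: local_homeo_open => //; apply: openI => //.
  by apply: open_comp => // x _; exact: cr.
have cA k : closed (A k).
  apply: compact_closed => //; apply: continuous_compact.
    exact: continuous_subspaceT.
  apply: compact_closedI => //; apply: preimage_closed => [x _|]; first exact: cr.
  exact: compact_closed.
rewrite openE => v [Gv vtau]; apply: (@filterS _ _ _
  (G0 `&` [set w | forall k, (w \in A k) = (v \in A k)])).
  by move=> w [Gw wv]; split=> //; rewrite -vtau; apply/setP => k; rewrite !AE.
apply: filterI; first exact: open_nbhs_nbhs.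
apply: filter_forall => k; have [vA|vA] := boolP (v \in A k).
  apply: (@filterS _ _ _ (A k)) => [w wA|]/=; first exact: mem_set.
  by apply: open_nbhs_nbhs; split=> //; exact: set_mem.
apply: (@filterS _ _ _ (~` A k)) => [w wA|]/=; first exact: memNset.
by apply: open_nbhs_nbhs; split; [exact: closed_openC|move/negP: vA => vA /mem_set].
Qed.

Lemma orbit_tower_open l i j : open (orbit_tower l i j).
Proof.
rewrite openE => z [a [b [[-> -> Hz Pa Pb] zl]]].
apply: (@filterS _ _ _ (H `&` r @^-1` P a `&` (s @^-1` P b) `&`
    s @^-1` [set v | G0 v /\ orbit_type v = orbit_type (s z)])).
  by move=> w [[[Hw Pw] Pw'] [_ /= tw]]; exists a, b; split=> //; rewrite tw.
apply: open_nbhs_nbhs; split; last by split=> //; split=> //; exact: unit_s grpd _.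
have oc (f : T -> T) (U : set T) : continuous f -> open U -> open (f @^-1` U).
  by move=> cf oU; apply: open_comp => // x _; exact: cf.
apply: openI; last by apply: (oc s) => //; exact: open_type.
apply: openI; last exact: (oc s).
by apply: openI => //; exact: (oc r).
Qed.

Definition tower_set : set nat := range (@choice.pickle {set 'I_m}).

Lemma orbit_castle (Q : set T -> Prop) :
  open_castle G0 s r mul tower_set (tower_index Q) orbit_tower.
Proof.
split; last by move=> *; exact: orbit_tower_open.
split.
- exact/finite_image/finite_finset.
- move=> l _; split.
  + apply: (@sub_finite_set _ _ [set i | (i < m)%N]); last exact: finite_II.
    by move=> _ [tau [a [_ _ -> _]]] /=.
  + by move=> *; exact: orbit_tower_bisection.
  + by move=> i j k _ Fj _; exact: orbit_tower_prod Fj.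
  + by move=> i _; exact: orbit_tower_unit.
  + move=> i j _ _ ij; apply/seteqP; split=> // z [/orbit_tower_range[a [ia Pa _]]].
    move=> /orbit_tower_range[b [jb Pb _]]; apply: ij.
    by rewrite ia jb (Pdisj Pa Pb).
(* Composable arrows share the type of the unit between them, so towers of different types have
   empty product. *)
- move=> l l' i j i' j' _ _ ll' _ _ _ _; apply/seteqP; split=> // w.
  move=> [x [y [[a [b [_ xl]]] /orbit_tower_range[c [_ _ yl]] xy _]]].
  by apply: ll'; rewrite -xl -yl xy.
Qed.

Section Subequivalence.
Variables B O : set T.
Hypothesis Bdec : forall k, P k `<=` B \/ P k `<=` ~` B.
Hypothesis Odec : forall k, P k `<=` O \/ P k `<=` ~` O.
Hypothesis fin_fibre : forall u, G0 u -> finite_set (fibre s H u).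
Hypothesis card_fibre : forall u, G0 u ->
  (#|` fset_set (fibre s H u `&` r @^-1` B)| <=
   #|` fset_set (fibre s H u `&` r @^-1` O)|)%N.

(** Every piece of the type contains a point of the orbit of [u], and only one since towers are
    bisections. The comparison of orbit points in [B] and in [O] thus becomes one of pieces, with
    [M] equal to 1 in both counting steps. *)
Lemma orbit_type_injection u : G0 u -> exists f : 'I_m -> 'I_m,
  (forall k, k \in orbit_type u -> P k `<=` B ->
     f k \in orbit_type u /\ P (f k) `<=` O) /\
  (forall j k, j \in orbit_type u -> P j `<=` B ->
     k \in orbit_type u -> P k `<=` B -> f j = f k -> j = k).
Proof.
move=> Gu.
pose X := [set k | k \in orbit_type u /\ P k `<=` B].
pose Y := [set k | k \in orbit_type u /\ P k `<=` O].
have fin (Z : set 'I_m) : finite_set Z by exact: finite_finset.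
have finF (Z : set T) : finite_set (fibre s H u `&` Z).
  by apply: sub_finite_set (fin_fibre Gu) => ? [].
have leX : (#|` fset_set X| <= 1 * #|` fset_set (fibre s H u `&` r @^-1` B)|)%N.
  apply: (@card_fset_set_le_mul _ _ 1 _ _ (fun=> fun k x => P k (r x))) => //.
    move=> k [/orbit_typeP[z [Hz sz Pz]] PB]; exists ord0, z; split=> //.
    by split=> //; exact: PB.
  by move=> _ j k x _ _; exact: Pdisj.
have leY : (#|` fset_set (fibre s H u `&` r @^-1` O)| <= 1 * #|` fset_set Y|)%N.
  apply: (@card_fset_set_le_mul _ _ 1 _ _ (fun=> fun x k => P k (r x))) => //.
    move=> x [[Hx sx] Ox]; have [k Pk] := Pcov (unit_r grpd x).
    exists ord0, k; split=> //; split; first by rewrite -sx; exact: mem_orbit_type.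
    by have [//|/(_ _ Pk)] := Odec k.
  move=> _ x x' k [[Hx sx] _] [[Hx' sx'] _] Px Px'.
  have [b Pb] := Pcov Gu.
  have [bis _] := @orbit_tower_bisection (choice.pickle (orbit_type u)) k b.
  by apply: bis; rewrite ?sx ?sx'//; exists k, b; rewrite ?sx ?sx'.
rewrite !mul1n in leX leY.
have := leq_trans leX (leq_trans (card_fibre Gu) leY).
move=> /(card_fset_set_le_inj (fin _) (fin _))[f [fXY finj]].
by exists f; split=> [k ku kB|j k ju jB ku kB]; [exact: fXY|exact: finj].
Qed.

(** The witnesses run from a piece inside [B] to its image under an injection into pieces inside
    [O]. A range determines the type and the target piece, hence by injectivity the source piece,
    which makes the ranges disjoint. *)
Lemma orbit_castle_remainder :
  subequiv s r (G0 `\` castle_levels tower_set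
    (tower_index (fun U => U `<=` ~` B)) orbit_tower) O.
Proof.
(* The injection is chosen per type and not per unit, so that each witness is a whole tower member;
   types that no unit has receive [id]. *)
have /choice[f fP] (tau : {set 'I_m}) : exists f : 'I_m -> 'I_m,
    (exists2 u, G0 u & orbit_type u = tau) ->
    (forall k, k \in tau -> P k `<=` B -> f k \in tau /\ P (f k) `<=` O) /\
    (forall j k, j \in tau -> P j `<=` B -> k \in tau -> P k `<=` B ->
       f j = f k -> j = k).
  have [[u Gu <-]|] := pselect (exists2 u, G0 u & orbit_type u = tau); last by exists id.
  by have [f ?] := orbit_type_injection Gu; exists f.
pose A (p : {set 'I_m} * 'I_m) := if `[< p.2 \in p.1 /\ P p.2 `<=` B >]
  then orbit_tower (choice.pickle p.1) (f p.1 p.2) p.2 else set0.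
have AP p z : A p z -> [/\ orbit_type (r z) = p.1, p.2 \in p.1, P p.2 `<=` B &
    P (f p.1 p.2) (r z)].
  rewrite /A; case: asboolP => // -[pp pB] /orbit_tower_range[a [/val_inj -> Pa]].
  by move=> /(pcan_inj choice.pickleK) ->.
apply: (@subequiv_finType _ _ _ _ A).
- move=> p; rewrite /A; case: asboolP => _.
    by split; [exact: orbit_tower_open|exact: orbit_tower_bisection].
  by split; [exact: open0|split].
- move=> v [Gv Nv]; have [k Pk] := Pcov Gv; have Hv := G0H Gv.
  have kv : k \in orbit_type v.
    by rewrite -(s_unit grpd Gv); apply: mem_orbit_type => //; rewrite (r_unit grpd).
  have PkB : P k `<=` B.
    (* A unit in a piece avoiding [B] would already lie in a level of the small castle. *)
    have [//|PkNB] := Bdec k; exfalso; apply: Nv.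
    exists (choice.pickle (orbit_type v)), k; split; first by exists (orbit_type v).
      by exists (orbit_type v), k.
    by exists k, k; rewrite (s_unit grpd)// (r_unit grpd).
  have [fv _] := fP (orbit_type v) (ex_intro2 _ _ v Gv erefl).
  have [/orbit_typeP[z [Hz sz Pz]] _] := fv k kv PkB.
  exists (orbit_type v, k) => //; exists z => //; rewrite /A asboolT//=.
  by exists (f (orbit_type v) k), k; rewrite sz.
- move=> p _ [z /AP[tyz pp pB Pz] <-].
  have [|fv _] := fP p.1; first by exists (r z) => //; exact: (unit_r grpd).
  by have [_] := fv _ pp pB; apply.
- move=> [tau k] [tau' k'] z z' /AP[/= tz kt kB Pz] /AP[/= tz' kt' kB' Pz'] rzz.
  have tt : tau' = tau by rewrite -tz -tz' rzz.
  rewrite tt in kt' Pz' *; congr pair.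
  have [|_ finj] := fP tau; first by exists (r z) => //; exact: (unit_r grpd).
  by apply: finj => //; apply: Pdisj Pz _; rewrite rzz.
Qed.

End Subequivalence.
End Topology.
End OrbitTypeCastle.

(** * Absorbing bisections and counting in orbits *)

Section Counting.
Context {T : topologicalType} (G0 : set T) (s r : T -> T)
  (mul : T -> T -> T) (inv : T -> T).
Hypothesis grpd : groupoid_axioms G0 s r mul inv.

Definition compact_open_bisection (A : set T) : Prop :=
  [/\ compact A, open A & bisection s r A].

Lemma compact_bisection_cover (K : set T) : ample s r -> compact K ->
  exists M (Bs : 'I_M -> set T),
    (forall i, compact_open_bisection (Bs i)) /\ K `<=` \bigcup_i Bs i.
Proof.
move=> amp cK; apply: compact_finite_cover => // x _.
by have [A [? ? ? ? _]] := amp x setT openT I; exists A.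
Qed.

(** Minimality gives an arrow from each [v] into [O], ampleness enlarges it to a compact open
    bisection with range in [O], and finitely many sources cover the compact unit space. *)
Lemma bisection_cover_into (O : set T) :
  ample s r -> continuous r -> local_homeo s -> compact G0 ->
  minimal_groupoid G0 s r -> open O -> O `<=` G0 -> O !=set0 ->
  exists M (Bs : 'I_M -> set T), (forall i, compact_open_bisection (Bs i)) /\
    forall v, G0 v -> exists i k, [/\ Bs i k, s k = v & O (r k)].
Proof.
move=> amp cr ls cG min oO OG [v0 Ov0].
have [v Gv|M [U [UP cov]]] := @compact_finite_cover _ G0
    (fun U => exists A, [/\ compact_open_bisection A, r @` A `<=` O & U = s @` A]) cG.
  have [_ [[x /= sx <-] Ox]] := min v Gv v0 (OG _ Ov0) O (open_nbhs_nbhs (conj oO Ov0)).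
  have oU : open (r @^-1` O) by apply: open_comp => // y _; exact: cr.
  have [A [cA oA bA Ax AO]] := amp x _ oU Ox.
  exists (s @` A); split; [exact: local_homeo_open|by exists x|].
  by exists A; split=> // _ [y /AO ? <-].
have /choice[Bs BsP] := UP; exists M, Bs; split=> [i|v /cov[i _]].
  by have [] := BsP i.
have [_ BO ->] := BsP i; move=> [k Bk kv]; exists i, k; split=> //.
by apply: BO; exists k.
Qed.

Lemma absorbing_bisections (K O : set T) :
  ample s r -> continuous r -> local_homeo s -> compact G0 ->
  minimal_groupoid G0 s r -> compact K -> open O -> O `<=` G0 -> O !=set0 ->
  exists M (Bs : 'I_M -> set T),
    [/\ forall i, compact_open_bisection (Bs i), K `<=` \bigcup_i Bs i &
        forall v, G0 v -> exists i k, [/\ Bs i k, s k = v & O (r k)]].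
Proof.
move=> amp cr ls cG min cK oO OG O0.
have [M1 [B1 [B1P covK]]] := compact_bisection_cover amp cK.
have [M2 [B2 [B2P covO]]] := bisection_cover_into amp cr ls cG min oO OG O0.
pose Bs (i : 'I_(M1 + M2)) := match fintype.split i with inl j => B1 j | inr j => B2 j end.
exists (M1 + M2)%N, Bs; split.
- by move=> i; rewrite /Bs; case: fintype.split.
- move=> x /covK[i _ Bx]; exists (lshift M2 i) => //.
  by rewrite /Bs (unsplitK (inl i : 'I_M1 + 'I_M2)).
- move=> v /covO[i [k [Bk sk Ok]]]; exists (rshift M1 i), k; split=> //.
  by rewrite /Bs (unsplitK (inr i : 'I_M1 + 'I_M2)).
Qed.

Variables (M : nat) (Bs : 'I_M -> set T) (H O : set T).
Hypothesis prH : principal_subgroupoid G0 s r mul inv H.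
Hypothesis bis : forall i, bisection s r (Bs i).
Hypothesis into_O : forall v, G0 v -> exists i k, [/\ Bs i k, s k = v & O (r k)].

Let K := \bigcup_i Bs i.
Let B := s @` (K `\` H).

(** Write a, g, o, n, e for the numbers of arrows of the fibre with range in [B], outside [B], in
    [O], of all arrows in it, and of the arrows leaving it. An arrow of [K] outside [H] carries a
    point of [B] out of the fibre, so a <= M e. Outside [B] every arrow of [K] is in [H], including
    one into [O], so g <= M o. Then (M+1) a <= n <= a + M o. *)
Lemma card_fibre_le (u : T) :
  finite_set (fibre s H u) ->
  finite_set (setprod s r mul K (fibre s H u) `\` fibre s H u) ->
  (M.+1 * M * #|` fset_set (setprod s r mul K (fibre s H u) `\` fibre s H u)|
    <= #|` fset_set (fibre s H u)|)%N ->
  (#|` fset_set (fibre s H u `&` r @^-1` B)| <=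
   #|` fset_set (fibre s H u `&` r @^-1` O)|)%N.
Proof.
set Hu := fibre s H u; set E := setprod _ _ _ _ _ `\` _ => fH fE leE.
have finI (Z : set T) : finite_set (Hu `&` Z) by apply: sub_finite_set fH => ? [].
have bad : (#|` fset_set (Hu `&` r @^-1` B)| <= M * #|` fset_set E|)%N.
  apply: (card_translate_le grpd bis) => // x [[Hx sx] [k [[i _ Bk] NHk] kx]].
  exists i, k; split=> //; split.
    by exists k, x; split=> //; exists i.
  move=> [Hkx _]; apply: NHk; rewrite -(mulVK grpd kx).
  apply: (principal_mul prH) => //; first exact: principal_inv prH _ _.
  by rewrite (s_mul grpd)// (r_inv grpd).
have good : (#|` fset_set (Hu `&` ~` (r @^-1` B))| <= M * #|` fset_set (Hu `&` r @^-1` O)|)%N.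
  apply: (card_translate_le grpd bis) => // x [[Hx sx] NB].
  have [i [k [Bk kx Ok]]] := into_O (unit_r grpd x).
  have Hk : H k.
    by apply: contrapT => NHk; apply: NB; exists k => //; split=> //; exists i.
  exists i, k; split=> //; split; last by rewrite /= (r_mul grpd).
  by split; [exact: (principal_mul prH)|rewrite (s_mul grpd)].
have tot : (#|` fset_set Hu| <= #|` fset_set (Hu `&` r @^-1` B)| +
    #|` fset_set (Hu `&` ~` (r @^-1` B))|)%N.
  rewrite -{1}(setIT Hu) -(setUv (r @^-1` B)) setIUr fset_setU// cardfsU.
  exact: leq_subr.
move: bad good tot leE; move: #|` _| #|` _| #|` _| #|` _| #|` _| => a e g o n.
(* For [M] zero the bound [bad] already gives a = 0; otherwise [M] is cancelled. *)
case: M => [|M']; nia.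
Qed.

End Counting.

(** * From almost finiteness to the two castles *)

Lemma almost_finite_nat (T : topologicalType) (G0 : set T) (s r : T -> T)
    (mul : T -> T -> T) (inv : T -> T) (K : set T) (c : nat) :
  almost_finite G0 s r mul inv -> compact K ->
  exists H : set T,
    [/\ compact H, open H, principal_subgroupoid G0 s r mul inv H, G0 `<=` H &
    forall u, G0 u ->
      [/\ finite_set (fibre s H u),
          finite_set (setprod s r mul K (fibre s H u) `\` fibre s H u) &
          (c * #|` fset_set (setprod s r mul K (fibre s H u) `\` fibre s H u)|
             <= #|` fset_set (fibre s H u)|)%N]].
Proof.
move=> af cK.
(* The tolerance is the inverse of [c.+1], which is defined even for [c] zero. *)
have eps0 : (0 < c.+1%:R^-1 :> Rdefinitions.R)%R by rewrite invr_gt0 ltr0n.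
have [H [cH oH prH GH HP]] := af K _ cK (elimT RltP eps0).
exists H; split=> // u /HP[fH fE /RltP lt]; split=> //.
move: lt; rewrite /Defs.fcard RmultE mulrC ltr_pdivlMr ?ltr0n//.
rewrite -natrM ltr_nat => /ltnW; apply: leq_trans.
by rewrite mulnC leq_mul2l leqnSn orbT.
Qed.

Theorem theorem6p4 (T : topologicalType) (G0 : set T) (s r : T -> T)
    (mul : T -> T -> T) (inv : T -> T) :
  hausdorff_space T -> locally_compact [set: T] -> @sigma_compact T ->
  etale_groupoid G0 s r mul inv -> ample s r -> compact G0 ->
  minimal_groupoid G0 s r -> almost_finite G0 s r mul inv ->
  almost_elementary G0 s r mul.
Proof.
move=> hT _ _ [[grpd cs cr _ _] [lr ls]] amp cG min af K O Vs cK _ oO OG [v0 Ov0] VsP Vscov.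
have oG := unit_space_open grpd cr lr.
(* The compact open [W] inside [O] is clopen, so small pieces lie inside it or miss it. *)
have [W [cW oW _ Wv0 WO]] := amp v0 O oO Ov0.
have [|M [Bs [BsP covK into_O]]] := absorbing_bisections amp cr ls cG min cK oW
  (subset_trans WO OG); first by exists v0.
set K' := \bigcup_i Bs i in covK.
have cK' : compact K' by apply: bigcup_fin_compact => i; have [] := BsP i.
have oK' : open K' by apply: bigcup_open => i _; have [] := BsP i.
have [H [cH oH prH GH HP]] := almost_finite_nat (M.+1 * M) af cK'.
pose B := s @` (K' `\` H).
have clB : closed B.
  apply: compact_closed => //; apply: continuous_compact.
    exact: continuous_subspaceT.
  exact: compact_setD.
have oB : open B.
  by apply: local_homeo_open => //; apply: open_setD => //; exact: compact_closed.
have clW : closed W by exact: compact_closed.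
(* All four demands on a piece pass to subsets, as the clopen partition requires. *)
pose Q (U : set T) := [/\ exists2 V, Vs V & U `<=` V,
  U `<=` B \/ U `<=` ~` B, U `<=` W \/ U `<=` ~` W &
  forall z, H z -> U (r z) -> U (s z) -> G0 z].
have Qsub U V : V `<=` U -> Q U -> Q V.
  move=> VU [[V' VsV' UV] UB UO Usep]; split.
  - by exists V' => //; exact: subset_trans UV.
  - by case: UB => UB; [left|right]; exact: subset_trans UB.
  - by case: UO => UO; [left|right]; exact: subset_trans UO.
  - by move=> z Hz Vr Vs'; apply: Usep => //; exact: VU.
have clopen_nbhs (A : set T) u : open A -> closed A ->
    exists U, [/\ open U, U u & U `<=` A \/ U `<=` ~` A].
  move=> oA cA; have [Au|NAu] := pselect (A u).
    by exists A; split=> //; left.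
  by exists (~` A); split=> //; [exact: closed_openC|right].
have Qloc u : G0 u -> exists U, [/\ compact U, open U, U u & Q U].
  move=> Gu; have [V VsV Vu] := Vscov u Gu; have [oV _] := VsP V VsV.
  have [UB [oUB UBu UBP]] := clopen_nbhs B u oB clB.
  have [UO [oUO UOu UOP]] := clopen_nbhs W u oW clW.
  have [N [Nu Nsep]] := principal_separation prH u hT cs cr oG cH.
  have [||U [cU oU _ Uu UP]] := amp u (V `&` UB `&` UO `&` N°).
  - by apply: openI; [do 2![apply: openI => //]|exact: open_interior].
  - by [].
  exists U; split=> //; split.
  - by exists V => // x /UP[[[]]].
  - by case: UBP => UBP; [left|right] => x /UP[[[_ /UBP]]].
  - by case: UOP => UOP; [left|right] => x /UP[[_ /UOP]].
  - move=> z Hz /UP[_ /interior_subset Nr] /UP[_ /interior_subset Ns].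
    exact: Nsep Hz Nr Ns.
have [m [P [PP Pdisj Pcov]]] := fine_clopen_partition hT cG Qsub Qloc.
have cP k : compact (P k) by have [] := PP k.
have oP k : open (P k) by have [] := PP k.
have Psep k z : H z -> P k (r z) -> P k (s z) -> G0 z.
  by have [_ _ [_ _ _ sep]] := PP k; exact: sep.
pose F := tower_index P (fun U => U `<=` ~` B).
pose E := tower_index P (fun=> True).
pose D := orbit_tower s r H P.
exists (tower_set m), F, E, D, D; split.
- exact: (orbit_castle grpd prH Pdisj Psep hT cs cr ls oG cH oH cP oP).
- exact: (orbit_castle grpd prH Pdisj Psep hT cs cr ls oG cH oH cP oP).
- split=> //.
    by move=> l _ _ [tau [a [? ? -> _]]]; exists tau, a.
  move=> _ [k [x [Kk [l [i [j [_ [tau [a [_ _ ia PaB]]] _ Dx]]]] kx ->]]].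
  have [a' [b [[ia' _ Hx Pa' _] _]]] := Dx.
  have Hk : H k.
    (* If [k] were outside [H], its source [r x] would lie in [B], but the piece of [r x] avoids
       [B]. *)
    apply: contrapT => NHk; apply: (PaB (r x)); last first.
      by exists k => //; split=> //; exact: covK.
    by rewrite ia' in ia; rewrite -(val_inj ia).
  have Hkx : H (mul k x) by exact: (principal_mul prH).
  have [i' [j' [Ei Ej Dij]]] := orbit_towers_cover grpd GH Pcov Hkx.
  exists (choice.pickle (orbit_type s r H P (s (mul k x)))), i', j'; split=> //.
  by exists (orbit_type s r H P (s (mul k x))).
- move=> l i _ [tau [a [_ _ -> _]]]; have [_ _ [[V VsV PV] _ _ _]] := PP a.
  exists V => // z Dz; have Gz := orbit_tower_unit Psep Dz.
  have [a' [b [[/val_inj aa' _ _ Pz _] _]]] := Dz.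
  by apply: PV; rewrite aa' -(r_unit grpd Gz).
- have [n [A [obA cov rA disj]]] : subequiv s r (G0 `\` castle_levels (tower_set m) F D) W.
    apply: (orbit_castle_remainder grpd prH GH Pdisj Pcov Psep hT cs cr ls oG cH oH cP oP).
    + by move=> k; have [_ _ []] := PP k.
    + by move=> k; have [_ _ []] := PP k.
    + by move=> u /HP[].
    + move=> u /HP[fH fE leE].
      apply: (card_fibre_le grpd prH _ into_O fH fE leE) => i.
      by have [] := BsP i.
  by exists n, A; split=> // i /rA; move=> rO; exact: subset_trans WO.
Qed.
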